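(* Let $\Sigma$ be a non-empty finite or countably infinite alphabet and let $\mu$ be a probability map over $\Sigma$ such that there exists at least one $\mu$-distributed sequence $\alpha\in\Sigma^\omega$. Then the following are equivalent: (1) $\mu$ is induced by a positive Bernoulli distribution $p$ on $\Sigma$, i.e. $p(a)>0$ for all $a\in\Sigma$ and $\mu(a_1\cdots a_n)=\prod_{i=1}^n p(a_i)$ for all $a_1,\dots,a_n\in\Sigma$; (2) (Postnikova property) for every $w\in\Sigma^*$ and every $\mu$-distributed $\alpha\in\Sigma^\omega$, if the sequence $\mathcal S_w[\alpha]$ selected from $\alpha$ by the Postnikova strategy $\mathcal S_w=\{vw : v\in\Sigma^*\}$ is infinite, then it is $\mu$-distributed; (3) (Agafonov property) for every DFA $A$ over $\Sigma$ and every $\mu$-distributed $\alpha\in\Sigma^\omega$, if the sequence $A[\alpha]$ selected from $\alpha$ by $A$ is infinite, then it is $\mu$-distributed.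
   Context: $\Sigma^*$, $\Sigma^+$, $\Sigma^\omega$ denote finite, non-empty finite, and right-infinite sequences over $\Sigma$; $\lambda$ is the empty word; for $\alpha=a_1a_2\cdots$, $\alpha|_{\le N}=a_1\cdots a_N$. A probability map over $\Sigma$ is a map $\mu:\Sigma^+\to[0,1]$ such that for every $n\ge1$, $\sum_{w\in\Sigma^n}\mu(w)=1$ (convention $\mu(\lambda)=1$). $\mu$ is induced by a Bernoulli distribution $p:\Sigma\to[0,1]$ (with $\sum_{a\in\Sigma}p(a)=1$) if $\mu(a_1\cdots a_n)=\prod_{i=1}^n p(a_i)$; $p$ is positive if $p(a)>0$ for all $a$. For $v=v_1\cdots v_N$ and $w=w_1\cdots w_n$, $\#_w(v)=|\{j\le N+1-n: v_j\cdots v_{j+n-1}=w\}|$. A sequence $\alpha\in\Sigma^\omega$ is $\mu$-distributed if for every $w\in\Sigma^+$, $\lim_{N\to\infty}\#_w(\alpha|_{\le N})/N$ exists and equals $\mu(w)$. A strategy is a set $S\subseteq\Sigma^*$; the sequence $S[\alpha]$ selected by $S$ from $\alpha=\alpha_1\alpha_2\cdots$ is the (finite or infinite) subsequence consisting of those $\alpha_i$ (in order) with $\alpha_1\cdots\alpha_{i-1}\in S$. A DFA over $\Sigma$ (where $\Sigma$ may be infinite) is $A=(Q,\Sigma,\delta,q_s,F)$ with $Q$ finite, $\delta:Q\times\Sigma\to Q$ total, start state $q_s$, accepting states $F$; $\delta^*$ is the extension to words; $A[\alpha]$ is $S[\alpha]$ for $S=\{u\in\Sigma^*:\delta^*(q_s,u)\in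 F\}$. *)

(* Defs.v *)
From HB Require Import structures.
From mathcomp Require Import all_boot all_order all_algebra.
From mathcomp Require Import all_classical all_reals all_analysis.
Set Implicit Arguments. Unset Strict Implicit. Unset Printing Implicit Defensive.
Import Order.TTheory GRing.Theory Num.Theory numFieldNormedType.Exports.
Local Open Scope classical_set_scope.
Local Open Scope ring_scope.

Section Defs.
Variables (R : realType) (S : countType).

(* Words are [seq S]; infinite sequences are [nat -> S] (0-indexed). *)

Definition prefix (alpha : nat -> S) (N : nat) : seq S := mkseq alpha N.

Definition occ (w v : seq S) : nat :=
  count (fun j => take (size w) (drop j v) == w) (iota 0 (size v + 1 - size w)).

(* probability map over S (mu on the empty word is 1 by convention) *)
Definition probability_map (mu : seq S -> R) : Prop :=
  mu [::] = 1 /\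
  (forall w : seq S, (0 < size w)%N -> 0 <= mu w <= 1) /\
  (forall n : nat, (1 <= n)%N ->
     (\esum_(w in [set w : seq S | size w = n]) (mu w)%:E = 1)%E).

Definition positive_bernoulli_induced (mu : seq S -> R) : Prop :=
  exists p : S -> R,
    (forall a, 0 < p a <= 1) /\
    (\esum_(a in [set: S]) (p a)%:E = 1)%E /\
    (forall w : seq S, (0 < size w)%N -> mu w = \prod_(a <- w) p a).

Definition mu_distributed (mu : seq S -> R) (alpha : nat -> S) : Prop :=
  forall w : seq S, (0 < size w)%N ->
    ((fun N : nat => (occ w (prefix alpha N))%:R / N%:R : R) @ \oo --> (mu w : R))%classic.

(* A strategy is a set of finite words; position i (0-indexed) is selected
   iff the prefix of length i belongs to the strategy. *)
Definition strategy := set (seq S).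

Definition selection_infinite (St : strategy) (alpha : nat -> S) : Prop :=
  forall m : nat, exists i : nat, (m <= i)%N /\ St (prefix alpha i).

(* sigma enumerates, in increasing order, exactly the selected positions;
   the selected sequence St[alpha] is then alpha \o sigma. *)
Definition enumerates_selection (St : strategy) (alpha : nat -> S)
    (sigma : nat -> nat) : Prop :=
  (forall n, (sigma n < sigma n.+1)%N) /\
  (forall n, St (prefix alpha (sigma n))) /\
  (forall i, St (prefix alpha i) -> exists n, sigma n = i).

Definition selected_distributed_if_infinite (mu : seq S -> R)
    (St : strategy) (alpha : nat -> S) : Prop :=
  selection_infinite St alpha ->
  forall sigma, enumerates_selection St alpha sigma ->
    mu_distributed mu (alpha \o sigma).

Definition postnikova_strategy (w : seq S) : strategy :=
  [set u | exists v : seq S, u = v ++ w].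

Definition postnikova_property (mu : seq S -> R) : Prop :=
  forall (w : seq S) (alpha : nat -> S), mu_distributed mu alpha ->
    selected_distributed_if_infinite mu (postnikova_strategy w) alpha.

Definition dfa_strategy (Q : finType) (delta : Q -> S -> Q) (qs : Q)
    (F : {set Q}) : strategy :=
  [set u | foldl delta qs u \in F].

Definition agafonov_property (mu : seq S -> R) : Prop :=
  forall (Q : finType) (delta : Q -> S -> Q) (qs : Q) (F : {set Q})
         (alpha : nat -> S), mu_distributed mu alpha ->
    selected_distributed_if_infinite mu (dfa_strategy delta qs F) alpha.

End Defs.

(* Main.v *)
Require Import Defs.
From mathcomp Require Import all_boot all_order all_algebra.
From mathcomp Require Import all_classical all_reals all_analysis.
From mathcomp Require Import ring lra zify.

(**
Everything is phrased with errors that are [o(N)] (predicate [sublinear]), and with the number of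
prefixes of [alpha] that end with [w] in place of the number of occurrences of [w].

Bernoulli => Agafonov.  For a DFA with states [q_i] along [alpha], the sum
[sum_(i < N) 1_(q_i in F) (1_(alpha_i = a) - p a)] is [o(N)]: average it over windows of length [L].
The window starting at [i] is a function of [q_i] and of the next [L] letters; for each fixed
starting state it is, under the Bernoulli measure, a sum of [L] martingale differences, so it has
second moment at most [L].  Bounding by the sum over all starting states, and replacing the
alphabet by a finite set of letters of mass close to 1, the mean of [|window| / L] is [O(L^-1/2)].
Applied to the product of the DFA with an automaton recognizing that the selected word ends with
[w], this gives the frequency of [w a] in the selected sequence from that of [w].  The error stays
negligible because the selection has positive lower density: some word [u] drives every state
through [F] or into a state from which [F] is unreachable, and [u] has positive frequency.

Agafonov => Postnikova.  The words ending with [w] form a regular language.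

Postnikova => Bernoulli.  The frequency of [a] among the letters following [w] gives
[mu (w a) = mu w * mu a].  If [mu a = 0], an [alpha] modified on a set of density zero refutes the
Postnikova property.
*)

Set Implicit Arguments. Unset Strict Implicit. Unset Printing Implicit Defensive.
Import Order.TTheory GRing.Theory Num.Theory numFieldNormedType.Exports.
Local Open Scope classical_set_scope.
Local Open Scope ring_scope.

(** * Calculus of errors that are [o(N)] *)

Section Sublinear.
Variable R : realType.
Implicit Types (X Y : nat -> R) (e c : R).

Definition sublinear X : Prop :=
  forall e, 0 < e -> exists N0, forall N, (N0 <= N)%N -> `|X N| <= e * N%:R.

Lemma natr_ge_exists c : exists n : nat, c <= n%:R.
Proof.
by exists (Num.truncn c).+1; apply/ltW/truncnS_gt.
Qed.

Lemma sublinear_le X Y :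
  (forall N, `|X N| <= Y N) -> sublinear Y -> sublinear X.
Proof.
move=> XY sY e e0; have [N0 hN0] := sY e e0; exists N0 => N /hN0 h.
by apply: le_trans (XY N) (le_trans (ler_norm _) h).
Qed.

Lemma eq_sublinear X Y : X =1 Y -> sublinear X -> sublinear Y.
Proof. by move=> XY sX e e0; have [N0 h] := sX e e0; exists N0 => N; rewrite -XY; exact: h. Qed.

Lemma sublinearD X Y :
  sublinear X -> sublinear Y -> sublinear (fun N => X N + Y N).
Proof.
move=> sX sY e e0; have e2 : 0 < e / 2 by rewrite divr_gt0.
have [N1 h1] := sX _ e2; have [N2 h2] := sY _ e2.
exists (maxn N1 N2) => N; rewrite geq_max => /andP[/h1 {}h1 /h2 {}h2].
by apply: le_trans (ler_normD _ _) _; lra.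
Qed.

Lemma sublinear_bounded c X : (forall N, `|X N| <= c) -> sublinear X.
Proof.
move=> Xc e e0; have [n hn] := natr_ge_exists (c / e); exists n => N nN.
apply: le_trans (Xc N) _; rewrite mulrC -ler_pdivrMr //.
by apply: le_trans hn _; rewrite ler_nat.
Qed.

Lemma sublinear0 : sublinear (fun=> 0).
Proof. by apply: (@sublinear_bounded 0) => N; rewrite normr0. Qed.

Lemma sublinearZ c X : sublinear X -> sublinear (fun N => c * X N).
Proof.
move=> sX e e0; have c1 : 0 < `|c| + 1 by rewrite ltr_wpDl.
have [|N0 h] := sX (e / (`|c| + 1)); first by rewrite divr_gt0.
exists N0 => N /h {}h; rewrite normrM.
apply: le_trans (_ : (`|c| + 1) * `|X N| <= _).
  by rewrite ler_wpM2r // lerDl.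
by rewrite -ler_pdivlMl // mulrA [_^-1 * _]mulrC.
Qed.

Lemma sublinearN X : sublinear X -> sublinear (fun N => - X N).
Proof. by move=> sX; apply: eq_sublinear (sublinearZ (-1) sX) => N; rewrite mulN1r. Qed.

Lemma sublinearB X Y :
  sublinear X -> sublinear Y -> sublinear (fun N => X N - Y N).
Proof. by move=> sX sY; apply: sublinearD sX (sublinearN sY). Qed.

Lemma sublinear_sum (T : Type) (s : seq T) (X : T -> nat -> R) :
  (forall x, sublinear (X x)) -> sublinear (fun N => \sum_(x <- s) X x N).
Proof.
move=> sX; elim: s => [|x s IHs].
  by apply: eq_sublinear sublinear0 => N; rewrite big_nil.
by apply: eq_sublinear (sublinearD (sX x) IHs) => N; rewrite big_cons.
Qed.

(* The hypothesis [s M <= c * M] covers both shifts and selections of positive density. *)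
Lemma sublinear_comp c X (s : nat -> nat) : (forall M, M <= s M)%N ->
  (exists M0, forall M, (M0 <= M)%N -> (s M)%:R <= c * M%:R) ->
  sublinear X -> sublinear (fun M => X (s M)).
Proof.
move=> sge [M0 sle] sX e e0; have c1 : 0 < `|c| + 1 by rewrite ltr_wpDl.
have [|N0 h] := sX (e / (`|c| + 1)); first by rewrite divr_gt0.
exists (maxn M0 N0) => M; rewrite geq_max => /andP[/sle sM NM].
apply: le_trans (h _ (leq_trans NM (sge M))) _.
rewrite -mulrA; apply: ler_wpM2l (ltW e0) _ _ _; rewrite ler_pdivrMl //.
apply: le_trans sM _; rewrite ler_wpM2r //.
by rewrite (le_trans (ler_norm c)) // lerDl.
Qed.

Lemma sublinear_shift k X : sublinear X -> sublinear (fun M => X (M + k)%N).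
Proof.
apply: (@sublinear_comp 2); first by move=> M; rewrite leq_addr.
by exists k => M kM; rewrite -natrM ler_nat; lia.
Qed.

Lemma sublinear_shift_inv k X : sublinear (fun M => X (M + k)%N) -> sublinear X.
Proof.
move=> sX e e0; have [N0 h] := sX e e0.
exists (N0 + k)%N => N NN; have := h (N - k)%N; rewrite subnK; last lia.
move=> /(_ ltac:(lia)) /le_trans; apply; apply: ler_wpM2l; rewrite ?(ltW e0)// ler_nat; lia.
Qed.

(** Uniqueness of limits in this language: two frequencies coincide once [N] times their difference
    is negligible. *)
Lemma sublinear_natr_eq0 c : sublinear (fun N => c * N%:R) -> c = 0.
Proof.
move=> sc; apply/eqP/contraT => c0.
have [|N0 /(_ N0.+1 (leqnSn _))] := sc (`|c| / 2); first by rewrite divr_gt0 ?normr_gt0.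
rewrite normrM normr_nat ler_pM2r ?ltr0n//.
have : 0 < `|c| by rewrite normr_gt0.
lra.
Qed.

Lemma sublinear_cvgP c X :
  (fun N => X N / N%:R) @ \oo --> c <-> sublinear (fun N => X N - c * N%:R).
Proof.
have E N : (0 < N)%N -> `|X N - c * N%:R| = `|X N / N%:R - c| * N%:R.
  move=> N0; rewrite -[X in _ = _ * X](normr_nat R N) -normrM mulrBl divfK //.
  by rewrite pnatr_eq0 -lt0n.
split=> [/cvgrPdist_le h e e0|h].
  have /h [N0 _ hN0] := e0; exists N0.+1 => N NN; rewrite E; last lia.
  by apply: ler_wpM2r => //; rewrite distrC; apply/hN0/ltnW.
apply/cvgrPdist_le => e e0; have [N0 hN0] := h e e0; exists N0.+1 => // N /= NN.
rewrite distrC -(@ler_pM2r _ N%:R) ?ltr0n; last lia.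
by rewrite -E; [apply: hN0; lia|lia].
Qed.

End Sublinear.

(** * Counting the prefixes that end with a given word *)

Section Endings.
Variables (R : realType) (S : countType).
Implicit Types (w x : seq S) (alpha beta : nat -> S).

(** The test at time [k] is the Postnikova selection rule itself, and it unfolds letter by letter
    from the end of [w]. *)
Definition endings w alpha N : R := \sum_(k < N) (suffix w (mkseq alpha k))%:R.

Definition block alpha i L := mkseq (fun j => alpha (i + j)%N) L.

Lemma suffix_mkseqS w a alpha k :
  suffix (rcons w a) (mkseq alpha k.+1) = suffix w (mkseq alpha k) && (alpha k == a).
Proof. by rewrite mkseqS suffix_rcons andbC eq_sym. Qed.

Lemma suffix_mkseq_lt w alpha k : (k < size w)%N -> suffix w (mkseq alpha k) = false.
Proof.
by apply: contraTF => /size_suffix; rewrite size_mkseq leqNgt.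
Qed.

Lemma mkseqD alpha i L : mkseq alpha (i + L) = mkseq alpha i ++ block alpha i L.
Proof. by rewrite /block /mkseq iotaD map_cat add0n -[in iota i L](addn0 i) iotaDl -map_comp. Qed.

Lemma suffix_mkseqD w alpha i :
  suffix w (mkseq alpha (i + size w)) = (block alpha i (size w) == w).
Proof.
by rewrite mkseqD -{1}[w]cat0s suffix_catl ?size_mkseq // suffix0s andbT eq_sym.
Qed.

Lemma sum_block w alpha N :
  \sum_(i < N) (block alpha i (size w) == w)%:R = endings w alpha (N + size w) :> R.
Proof.
rewrite /endings addnC big_split_ord /= [X in _ = X + _]big1 ?add0r.
  by apply: eq_bigr => i _; rewrite addnC suffix_mkseqD.
by move=> i _; rewrite suffix_mkseq_lt.
Qed.

(** An occurrence within the first [N] letters ends at a length at most [N], whereas [endings]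
    counts lengths strictly below its argument; hence the shift by one. *)
Lemma occ_endings w alpha N : (0 < size w)%N ->
  (occ w (mkseq alpha N))%:R = endings w alpha N.+1.
Proof.
move=> w0; rewrite /occ size_mkseq addn1.
have [Nw|wN] := ltnP N (size w).
  have /eqP -> : (N.+1 - size w == 0)%N by rewrite subn_eq0.
  rewrite /endings big1 // => -[k /= kN] _.
  by rewrite suffix_mkseq_lt // (leq_trans kN).
rewrite -[in RHS](subnK (leqW wN)) -sum_block -sum1_count natr_sum big_mkcond /=.
rewrite (_ : iota 0 (N.+1 - size w) = index_iota 0 (N.+1 - size w));
  last by rewrite /index_iota subn0.
rewrite big_mkord; apply: eq_bigr => -[j /= jN] _.
have -> : N = (j + size w + (N - (j + size w)))%N by lia.
rewrite mkseqD take_drop addnC take_size_cat ?size_mkseq // mkseqD drop_size_cat ?size_mkseq //.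
by case: eqP.
Qed.

Lemma endings_rcons w a alpha N :
  endings (rcons w a) alpha N.+1 =
  \sum_(k < N) (suffix w (mkseq alpha k))%:R * (alpha k == a)%:R.
Proof.
rewrite /endings big_ord_recl /= suffix_mkseq_lt ?size_rcons // add0r.
by apply: eq_bigr => k _; rewrite suffix_mkseqS -natrM mulnb.
Qed.

Lemma endings_nil alpha N : endings [::] alpha N = N%:R.
Proof.
by rewrite /endings (eq_bigr (fun=> 1)) ?sumr_const ?card_ord// => i _; rewrite suffix0s.
Qed.

Lemma endings_ge0 w alpha N : 0 <= endings w alpha N.
Proof. exact: sumr_ge0. Qed.

Lemma mu_distributedP (mu : seq S -> R) alpha :
  mu_distributed mu alpha <->
  forall w, (0 < size w)%N ->
    sublinear (fun N => endings w alpha N - mu w * N%:R).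
Proof.
have E w : (0 < size w)%N ->
    ((fun N => (occ w (Defs.prefix alpha N))%:R / N%:R : R) @ \oo --> (mu w : R)) <->
    sublinear (fun N => endings w alpha N - mu w * N%:R).
  move=> w0; rewrite sublinear_cvgP; split => h.
    apply: (@sublinear_shift_inv _ 1).
    have h2 := sublinearB h (sublinear_bounded (fun=> lexx `|mu w|)).
    by apply: eq_sublinear h2 => N; rewrite /Defs.prefix occ_endings// addn1 -natr1; ring.
  have h2 := sublinearD (sublinear_shift 1 h) (sublinear_bounded (fun=> lexx `|mu w|)).
  by apply: eq_sublinear h2 => N; rewrite /Defs.prefix occ_endings// addn1 -natr1; ring.
by split=> h w w0; have /E[] := w0 => + +; [move/(_ (h w w0))|move=> _ /(_ (h w w0))].
Qed.

Lemma sublinear_endings (mu : seq S -> R) alpha w :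
  mu [::] = 1 -> mu_distributed mu alpha ->
  sublinear (fun N => endings w alpha N - mu w * N%:R).
Proof.
move=> mu1 /mu_distributedP h; case: w => [|b w]; last exact: h.
by apply: eq_sublinear (@sublinear0 R) => N; rewrite endings_nil mu1; ring.
Qed.

End Endings.

(** * Enumerations of the selected positions *)

Section Selection.
Variables (R : realType) (sel : pred nat) (sigma : nat -> nat).
Hypothesis sigmaS : forall n, (sigma n < sigma n.+1)%N.
Hypothesis sigma_sel : forall n, sel (sigma n).
Hypothesis sel_sigma : forall i, sel i -> exists n, sigma n = i.

Lemma sigma_lt m n : (m < n)%N -> (sigma m < sigma n)%N.
Proof.
elim: n => // n IHn; rewrite ltnS leq_eqVlt => /predU1P[->//|/IHn h].
exact: ltn_trans h (sigmaS n).
Qed.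

Lemma leq_sigma n : (n <= sigma n)%N.
Proof. by elim: n => // n IHn; apply: leq_ltn_trans IHn (sigmaS n). Qed.

(** Both lists are strictly increasing with the same members. Read through [alpha], this identifies
    the word selected before time [sigma M] with a prefix of length [M] of the selected sequence. *)
Lemma filter_selected M : [seq i <- iota 0 (sigma M) | sel i] = mkseq sigma M.
Proof.
apply: (irr_sorted_eq ltn_trans ltnn).
- by apply: sorted_filter; [exact: ltn_trans|exact: iota_ltn_sorted].
- by apply: homo_sorted (iota_ltn_sorted 0 M) => m n /sigma_lt.
move=> i; rewrite mem_filter mem_iota add0n /=; apply/andP/mapP => [[/sel_sigma[k <-] kM]|].
  exists k; rewrite // mem_iota add0n /= ltnNge; apply/negP; rewrite leq_eqVlt.
  by case/predU1P => [E|/sigma_lt]; [move: kM; rewrite E ltnn|lia].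
by move=> [k]; rewrite mem_iota => kM ->; split=> //; exact: sigma_lt.
Qed.

Lemma sum_selected (g : nat -> R) M :
  \sum_(i < sigma M) (sel i)%:R * g i = \sum_(k < M) g (sigma k).
Proof.
rewrite -(big_mkord predT (fun i => (sel i)%:R * g i)) -(big_mkord predT (fun k => g (sigma k))).
rewrite /index_iota !subn0 -(big_map sigma predT g) -/(mkseq sigma M).
rewrite -filter_selected big_filter [RHS]big_mkcond /=.
by apply: eq_bigr => i _; case: (sel i); rewrite ?mul1r ?mul0r.
Qed.

End Selection.

Lemma enumeration_exists (sel : pred nat) :
  (forall m, exists i, (m <= i)%N /\ sel i) ->
  exists sigma : nat -> nat, (forall n, (sigma n < sigma n.+1)%N) /\
    (forall n, sel (sigma n)) /\ (forall i, sel i -> exists n, sigma n = i).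
Proof.
move=> inf.
have ex m : exists i, (m <= i)%N && sel i by have [i [? ?]] := inf m; exists i; apply/andP.
pose nxt m := ex_minn (ex m).
have nxtP m : [/\ (m <= nxt m)%N, sel (nxt m) & forall i, (m <= i)%N -> sel i -> (nxt m <= i)%N].
  rewrite /nxt; case: ex_minnP => i /andP[? ?] h; split=> // j mj sj; apply: h; exact/andP.
pose sigma := fix sg n := if n is m.+1 then nxt (sg m).+1 else nxt 0%N.
have s1 n : (sigma n < sigma n.+1)%N by have [] := nxtP (sigma n).+1.
exists sigma; split=> //; split.
  by case=> [|n]; [have [] := nxtP 0%N|have [] := nxtP (sigma n).+1].
move=> i si.
have [n hn] : exists n, (i < sigma n)%N.
  by exists i.+1; apply: leq_trans (leq_sigma s1 i.+1).
elim: n hn => [|n IHn] hn; first by have [_ _ /(_ i isT si)] := nxtP 0%N; rewrite leqNgt hn.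
have [/IHn//|sn] := ltnP i (sigma n); exists n; apply/eqP; rewrite eqn_leq sn /= leqNgt.
by apply/negP => h; have [_ _ /(_ i h si)] := nxtP (sigma n).+1; rewrite leqNgt hn.
Qed.

(** * Windows, blocks and second moments over a finite set of letters *)

Section Words.
Variables (R : realType) (S : countType) (p : S -> R).
Implicit Types (B : seq S) (L N : nat).
Hypothesis p_ge0 : forall a, 0 <= p a.

(** The alphabet may be infinite, so sums over all words of length [L] are truncated to a finite
    list [B] of letters. *)
Fixpoint words B L : seq (seq S) :=
  if L is L'.+1 then [seq b :: x | b <- B, x <- words B L'] else [:: [::]].

Lemma size_words B L x : x \in words B L -> size x = L.
Proof.
elim: L x => [|L IHL] x /=; first by rewrite inE => /eqP ->.
by case/allpairsP => -[b y] /= [_ /IHL <- ->].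
Qed.

Lemma words_uniq B L : uniq B -> uniq (words B L).
Proof.
move=> uB; elim: L => [//|L IHL] /=; apply: allpairs_uniq => //.
by move=> [b x] [c y] _ _ /= [-> ->].
Qed.

Lemma big_wordsS B L (F : seq S -> R) :
  \sum_(x <- words B L.+1) F x = \sum_(b <- B) \sum_(x <- words B L) F (b :: x).
Proof. exact: big_allpairs_dep. Qed.

Lemma sum_words_prod B L :
  \sum_(x <- words B L) \prod_(a <- x) p a = (\sum_(b <- B) p b) ^+ L.
Proof.
elim: L => [|L IHL]; first by rewrite /= big_seq1 big_nil.
rewrite big_wordsS exprS mulr_suml; apply: eq_bigr => b _.
by rewrite -IHL mulr_sumr; apply: eq_bigr => x _; rewrite big_cons.
Qed.

Lemma esum_le1_seq B : uniq B -> (\esum_(a in [set: S]) (p a)%:E = 1)%E ->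
  \sum_(b <- B) p b <= 1.
Proof.
move=> uB p1; rewrite -lee_fin -p1 -sumEFin.
apply: esum_ge; exists [set` B]; first by split=> //; exact: finite_seq.
rewrite fsbig_finite /=; last exact: finite_seq.
rewrite (perm_big (finmap.enum_fset (fset_set [set` B]))) //=; apply: uniq_perm => // x.
by rewrite in_fset_set ?mem_setE//; exact: finite_seq.
Qed.

Lemma esum1_seq_ge (e : R) : 0 < e -> (\esum_(a in [set: S]) (p a)%:E = 1)%E ->
  exists2 B, uniq B & 1 - e <= \sum_(b <- B) p b.
Proof.
move=> e0 p1; apply: contrapT => noB.
have : (\esum_(a in [set: S]) (p a)%:E <= (1 - e)%:E)%E.
  apply: ge_ereal_sup => _ [X [finX _] <-]; rewrite fsbig_finite //= sumEFin lee_fin.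
  rewrite leNgt; apply/negP => /ltW h; apply: noB.
  by exists (finmap.enum_fset (fset_set X)); first exact: finmap.fset_uniq.
by rewrite p1 lee_fin; lra.
Qed.

(** With [x] the mass of [B], this bounds by [L * (1 - x)] the mass of the words of length [L] that
    leave [B]. *)
Lemma bernoulli_ineq (x : R) L : 0 <= x <= 1 -> 1 - L%:R * (1 - x) <= x ^+ L.
Proof.
move=> /andP[x0 x1]; elim: L => [|L IHL]; first by rewrite expr0 mul0r subr0.
have L0 : 0 <= L%:R :> R by [].
rewrite exprS -natr1; apply: le_trans (_ : x * (1 - L%:R * (1 - x)) <= _); last exact: ler_wpM2l.
have := mulr_ge0 L0 (sqr_ge0 (1 - x)); nra.
Qed.

Section Walk.
Variables (Q : finType) (delta : Q -> S -> Q) (f : Q -> S -> R).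

(** Separating the starting state from the word read splits a window into one of finitely many
    states and a block of known frequency. *)
Fixpoint walk q (x : seq S) : R :=
  if x is b :: x' then f q b + walk (delta q b) x' else 0.

Lemma walk_block alpha q i L :
  walk (foldl delta q (mkseq alpha i)) (block alpha i L) =
  \sum_(j < L) f (foldl delta q (mkseq alpha (i + j))) (alpha (i + j)%N).
Proof.
elim: L i => [|L IHL] i; first by rewrite big_ord0.
rewrite big_ord_recl /= !addn0; congr (_ + _).
have -> : [seq alpha (i + j)%N | j <- iota 1 L] = block alpha i.+1 L.
  rewrite (iotaDl 1 0) -map_comp; apply: eq_map => j /=; congr alpha; lia.
rewrite -foldl_rcons -mkseqS IHL; apply: eq_bigr => j _ /=.
by rewrite /bump /= addnA addn1.
Qed.

Lemma norm_walk q x : (forall q b, `|f q b| <= 1) -> `|walk q x| <= (size x)%:R.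
Proof.
move=> f1; elim: x q => [|b x IHx] q /=; first by rewrite normr0.
by apply: le_trans (ler_normD _ _) _; rewrite -natr1 addrC lerD.
Qed.

(* The increments are martingale differences, hence orthogonal. *)
Lemma second_moment B L q s :
  \sum_(b <- B) p b <= 1 -> (forall q b, `|f q b| <= 1) ->
  (forall q, \sum_(b <- B) p b * f q b = 0) ->
  \sum_(x <- words B L) (\prod_(a <- x) p a) * (s + walk q x) ^+ 2 <= s ^+ 2 + L%:R.
Proof.
move=> B1 f1 f0; elim: L q s => [|L IHL] q s.
  by rewrite /= big_seq1 big_nil mul1r !addr0.
rewrite big_wordsS.
apply: le_trans (_ : \sum_(b <- B) p b * ((s + f q b) ^+ 2 + L%:R) <= _).
  apply: ler_sum => b _; apply: le_trans (ler_wpM2l (p_ge0 b) (IHL (delta q b) _)).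
  rewrite mulr_sumr le_eqVlt; apply/orP; left; apply/eqP/eq_bigr => x _.
  by rewrite big_cons /= -mulrA addrA.
(* In the expanded square the cross term [2 * s * f q b] has mean zero over [B], and [f q b ^+ 2] is
   at most 1. *)
apply: le_trans (_ : \sum_(b <- B) (p b * (s ^+ 2 + 1 + L%:R) + p b * f q b * (2 * s)) <= _).
  apply: ler_sum => b _.
  have : f q b ^+ 2 <= 1 by rewrite -real_normK ?num_real// expr_le1.
  have := p_ge0 b => p0 h; have := ler_wpM2l p0 h; nra.
rewrite big_split /= -!mulr_suml f0 mul0r addr0 -natr1.
have L0 : 0 <= L%:R :> R by [].
have := sqr_ge0 s; nra.
Qed.

End Walk.

Lemma sum_block_words (W : seq (seq S)) L (phi : seq S -> R) alpha N :
  uniq W -> (forall x, x \in W -> size x = L) ->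
  \sum_(i < N) (block alpha i L \in W)%:R * phi (block alpha i L) =
  \sum_(x <- W) phi x * endings R x alpha (N + L).
Proof.
move=> uW sW; transitivity (\sum_(x <- W) \sum_(i < N) phi x * (block alpha i L == x)%:R).
  rewrite exchange_big; apply: eq_bigr => i _ /=.
  have [bW|bW] := boolP (_ \in W).
    rewrite (bigD1_seq (block alpha i L)) //= eqxx mul1r mulr1 big1 ?addr0// => x /negPf.
    by rewrite eq_sym => ->; rewrite mulr0.
  rewrite mul0r big1_seq // => x /= xW; case: eqP => [E|]; last by rewrite mulr0.
  by rewrite E xW in bW.
rewrite !(big_seq_cond predT) /=; apply: eq_bigr => x /andP[xW _].
by rewrite -mulr_sumr -(sW x xW) sum_block.
Qed.

(** Finiteness of [W] allows the errors of the single words to be added up. *)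
Lemma sublinear_block_words (W : seq (seq S)) L (phi : seq S -> R) alpha :
  uniq W -> (forall x, x \in W -> size x = L) ->
  (forall x, sublinear (fun N => endings R x alpha N - (\prod_(a <- x) p a) * N%:R)) ->
  sublinear (fun N => \sum_(i < N) (block alpha i L \in W)%:R * phi (block alpha i L) -
     (\sum_(x <- W) (\prod_(a <- x) p a) * phi x) * N%:R).
Proof.
move=> uW sW sub.
pose X x N := phi x * (endings R x alpha (N + L) - (\prod_(a <- x) p a) * (N + L)%:R)
  + phi x * ((\prod_(a <- x) p a) * L%:R).
have sX x : sublinear (X x).
  apply: sublinearD; first by apply/sublinearZ/(sublinear_shift L (sub x)).
  by apply: sublinear_bounded => N; exact: lexx.
apply: eq_sublinear (sublinear_sum W sX) => N.
rewrite sum_block_words // mulr_suml -sumrB; apply: eq_bigr => x _.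
by rewrite /X natrD; ring.
Qed.

(** Shifting the sum by [j] only affects [j] terms at each end, and there are [L] shifts, all
    shorter than [L]. *)
Lemma window_sum (g : nat -> R) L N : (forall k, `|g k| <= 1) ->
  `|L%:R * (\sum_(i < N) g i) - \sum_(i < N) \sum_(j < L) g (i + j)%N| <= L%:R * (2 * L%:R).
Proof.
move=> g1.
have sh j : `|\sum_(i < N) g i - \sum_(i < N) g (i + j)%N| <= 2 * j%:R.
  elim: j => [|j IHj].
    by under [X in _ - X]eq_bigr do rewrite addn0; rewrite subrr normr0 mulr0.
  have E : \sum_(i < N) g (i + j.+1)%N = \sum_(i < N) g (i + j)%N + g (N + j)%N - g j.
    have := big_ord_recr N (fun i : 'I_N.+1 => g (i + j)%N) : \sum_(i < N.+1) _ = _ + _.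
    rewrite big_ord_recl /= add0n => <-; rewrite addrC addKr.
    by apply: eq_bigr => i _; rewrite /bump /= addnS addSn.
  rewrite E -natr1; move: (g1 (N + j)%N) (g1 j) IHj.
  by rewrite !ler_norml; lra.
rewrite exchange_big /= -[L in L%:R * \sum_(i < N) _]card_ord -sumr_const mulr_suml -sumrB.
apply: le_trans (ler_norm_sum _ _ _) _.
rewrite mulr_natl -[L in _ *+ L]card_ord -sumr_const; apply: ler_sum => j _.
rewrite mul1r; apply: le_trans (sh j) _; apply: ler_wpM2l => //.
by rewrite ler_nat ltnW.
Qed.

End Words.

(** Follows from [(c - |y|)^2 >= 0]; it plays the role of Cauchy-Schwarz in passing from second to
    first moments. *)
Lemma ler_norm_sqr (R : realFieldType) (c y : R) : 0 < c -> `|y| <= c + c^-1 * y ^+ 2.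
Proof.
move=> c0; rewrite -(ler_pM2l c0) mulrDr mulrA divff ?gt_eqF// mul1r.
rewrite -(real_normK (num_real y)).
have := sqr_ge0 (c - `|y|); have := normr_ge0 y; nra.
Qed.

(** * Letter frequencies at the accepting times of an automaton *)

Section LetterFrequency.
Variables (R : realType) (S : countType) (p : S -> R) (alpha : nat -> S).
Hypothesis p_ge0 : forall a, 0 <= p a.
Hypothesis p_sum1 : (\esum_(a in [set: S]) (p a)%:E = 1)%E.
Hypothesis alpha_freq : forall x,
  sublinear (fun N => endings R x alpha N - (\prod_(a <- x) p a) * N%:R).
Variables (Q : finType) (delta : Q -> S -> Q) (qs : Q) (F : {set Q}).

Let state k := foldl delta qs (mkseq alpha k).

(** The three terms come from [ler_norm_sqr] with [c = L * t], from the second moments of the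
    windows over [B], and from the trivial bound [L] on the windows that leave [B]. *)
Lemma walk_average (f : Q -> S -> R) B L (t : R) :
  (0 < L)%N -> 0 < t -> uniq B -> (forall q b, `|f q b| <= 1) ->
  (forall q, \sum_(b <- B) p b * f q b = 0) ->
  exists2 Z, sublinear Z & forall N,
    L%:R * `|\sum_(i < N) f (state i) (alpha i)| <=
      N%:R * (L%:R * t + #|Q|%:R / t + L%:R * (1 - (\sum_(b <- B) p b) ^+ L)) + Z N.
Proof.
move=> L0 t0 uB f1 f0; set W := words B L.
have LR : 0 < L%:R :> R by rewrite ltr0n.
have Lt0 : 0 < L%:R * t by rewrite mulr_gt0.
(* The state at time [i] depends on the whole past; summing over all states leaves a function of the
   block alone. *)
pose phi x := (L%:R * t)^-1 * \sum_(q : Q) walk delta f q x ^+ 2.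
have phi_ge0 x : 0 <= phi x.
  by rewrite mulr_ge0 ?invr_ge0 ?(ltW Lt0)// sumr_ge0 // => q _; exact: sqr_ge0.
have sW x : x \in W -> size x = L := @size_words _ _ _ _.
have uW : uniq W := words_uniq L uB.
have := sublinear_block_words phi uW sW alpha_freq; set A := fun N => _ => sA.
have := sublinear_block_words (fun=> 1) uW sW alpha_freq; set C := fun N => _ => sC.
exists (fun N => L%:R * (2 * L%:R) + (A N + - L%:R * C N)).
  apply: sublinearD; first by apply: sublinear_bounded => N; exact: lexx.
  by apply: sublinearD sA (sublinearZ _ sC).
move=> N; pose g k := f (state k) (alpha k).
have win := @window_sum R g L N (fun k => f1 _ _).
have T i : `|\sum_(j < L) g (i + j)%N| <= L%:R * t +
    (block alpha i L \in W)%:R * phi (block alpha i L) +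
    L%:R * (1 - (block alpha i L \in W)%:R * 1).
  rewrite -walk_block -/(state i); set x := block _ _ _; set y := walk _ _ _ _.
  case: (x \in W); last first.
    have := @norm_walk R S Q delta f (state i) x f1.
    rewrite size_mkseq -/y !mul0r addr0 subr0 mulr1.
    by move=> h; apply: (le_trans h); rewrite lerDr ltW.
  have y2 : y ^+ 2 <= \sum_(q : Q) walk delta f q x ^+ 2.
    by rewrite (bigD1 (state i)) //= lerDl sumr_ge0 // => q _; exact: sqr_ge0.
  have h : (L%:R * t)^-1 * y ^+ 2 <= phi x by apply: ler_wpM2l; rewrite ?invr_ge0 ?(ltW Lt0).
  apply: le_trans (_ : L%:R * t + (L%:R * t)^-1 * y ^+ 2 <= _); last first.
    by rewrite mulr1 subrr mulr0 addr0 mul1r lerD2l.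
  exact: ler_norm_sqr.
have Ephi : \sum_(x <- W) (\prod_(a <- x) p a) * phi x <= #|Q|%:R / t.
  rewrite (eq_bigr (fun x => (L%:R * t)^-1 *
      \sum_(q : Q) (\prod_(a <- x) p a) * walk delta f q x ^+ 2)); last first.
    by move=> x _; rewrite -mulr_sumr /phi; ring.
  rewrite -mulr_sumr exchange_big /=.
  apply: le_trans (_ : (L%:R * t)^-1 * \sum_(q : Q) L%:R <= _).
    apply: ler_wpM2l; first by rewrite invr_ge0 (ltW Lt0).
    apply: ler_sum => q _.
    have := @second_moment R S p p_ge0 Q delta f B L q 0 (esum_le1_seq uB p_sum1) f1 f0.
    rewrite expr0n add0r; apply: le_trans; apply: ler_sum => x _.
    by rewrite add0r.
  rewrite sumr_const -[L%:R *+ _]mulr_natr le_eqVlt; apply/orP; left; apply/eqP.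
  by field; rewrite !gt_eqF.
have EC : \sum_(x <- W) (\prod_(a <- x) p a) * 1 = (\sum_(b <- B) p b) ^+ L.
  by rewrite -sum_words_prod; apply: eq_bigr => x _; rewrite mulr1.
have sumT : \sum_(i < N) `|\sum_(j < L) g (i + j)%N| <= N%:R * (L%:R * t) +
    \sum_(i < N) (block alpha i L \in W)%:R * phi (block alpha i L) +
    L%:R * (N%:R - \sum_(i < N) (block alpha i L \in W)%:R * 1).
  apply: le_trans; first by apply: ler_sum => i _; exact: T.
  rewrite !big_split /= -[X in _ + X]mulr_sumr sumrB !sumr_const card_ord.
  by rewrite -[L%:R * t *+ _]mulr_natl.
have N0 : 0 <= N%:R :> R by [].
have := ler_wpM2l N0 Ephi.
have := le_trans (ler_norm_sum _ _ _) sumT.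
rewrite /A /C EC; move: win; set P := _ ^+ L.
set G := \sum_(i < N) g i; set D := \sum_(i < N) \sum_(j < L) _.
move=> win h1 h2.
have := ler_normD (L%:R * G - D) D; rewrite subrK => h3.
move: h3; rewrite normrM normr_nat; lra.
Qed.

Lemma letter_frequency a :
  sublinear (fun N => \sum_(i < N) (state i \in F)%:R * ((alpha i == a)%:R - p a)).
Proof.
(* Five errors of size at most [t * N] arise: the three terms of [walk_average], its remainder [Z],
   and the passage from [f] to the centered indicator. *)
move=> e e0; pose t := e / 8; have t0 : 0 < t by rewrite divr_gt0.
have [L' hL'] := natr_ge_exists (#|Q|%:R / (t * t)); pose L := L'.+1.
have LR : 0 < L%:R :> R by rewrite ltr0n.
have QL : #|Q|%:R / t <= L%:R * t.
  have tt : 0 < t * t by rewrite mulr_gt0.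
  have : #|Q|%:R / (t * t) <= L%:R by apply: le_trans hL' _; rewrite ler_nat.
  by rewrite ler_pdivrMr// ler_pdivrMr// mulrA.
(* [B] is chosen after [L], so that words of length [L] leave it with mass at most
   [L * (t / L) = t]. *)
have [|B0 uB0 PB0] := @esum1_seq_ge R S p (t / L%:R) _ p_sum1; first by rewrite divr_gt0.
(* The letter [a] must lie in [B] for [f] to be centered there. *)
have [B [uB aB PB]] : exists B, [/\ uniq B, a \in B & 1 - t / L%:R <= \sum_(b <- B) p b].
  have [aB0|aB0] := boolP (a \in B0); first by exists B0.
  exists (a :: B0); rewrite mem_head /= aB0 uB0 big_cons; split=> //.
  by apply: le_trans PB0 _; rewrite lerDr.
set P := \sum_(b <- B) p b in PB.
have P1 : P <= 1 := esum_le1_seq uB p_sum1.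
have P0 : 0 <= P by apply: sumr_ge0.
have pa0 := p_ge0 a.
have pa1 : p a <= 1.
  by have := @esum_le1_seq R S p [:: a] isT p_sum1; rewrite big_seq1.
(* Scaling by [P] instead of dividing by it keeps [f] centered over [B]. *)
pose f q b : R := (q \in F)%:R * ((b == a)%:R * P - p a).
have f1 q b : `|f q b| <= 1.
  by rewrite /f ler_norml; case: (q \in F); case: (b == a); rewrite ?mul1r ?mul0r; lra.
have f0 q : \sum_(b <- B) p b * f q b = 0.
  rewrite (eq_bigr (fun b => (q \in F)%:R * (P * (p b * (b == a)%:R) - p b * p a))).
    rewrite -mulr_sumr sumrB -mulr_sumr -mulr_suml (bigD1_seq a) //= eqxx mulr1 big1.
      by rewrite addr0 subrr mulr0.
    by move=> b /negPf ->; rewrite mulr0.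
  by move=> b _; rewrite /f; ring.
have [Z sZ hZ] := walk_average (ltn0Sn L' : (0 < L)%N) t0 uB f1 f0.
have [|N0 hN0] := sZ (L%:R * t); first by rewrite mulr_gt0.
exists N0 => N /hN0 ZN; have {hZ} := hZ N.
have NR : 0 <= N%:R :> R by [].
have tL : L%:R * (1 - P) <= t.
  by rewrite -ler_pdivlMl // mulrC; lra.
have PL : 1 - P ^+ L <= t.
  by have := @bernoulli_ineq R P L; rewrite P0 P1 => /(_ isT); lra.
have P1t : 1 - P <= t.
  apply: le_trans tL; rewrite -[X in X <= _]mul1r; apply: ler_wpM2r; first lra.
  by rewrite ler1n.
set Y := \sum_(i < N) f _ _ => hY.
have {hY} Yt : `|Y| <= N%:R * (4 * t).
  rewrite -(ler_pM2l LR); apply: le_trans hY _.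
  have : L%:R * (1 - P ^+ L) <= L%:R * t by apply: ler_wpM2l => //; exact: ltW.
  move=> h; have {}h := ler_wpM2l NR (lerD QL h).
  move: (le_trans (ler_norm _) ZN); lra.
set X := \sum_(i < N) _.
have XY : `|X - Y| <= N%:R * t.
  rewrite /X /Y -sumrB; apply: le_trans (ler_norm_sum _ _ _) _.
  rewrite mulr_natl -[N in _ *+ N]card_ord -sumr_const; apply: ler_sum => i _.
  rewrite /f ler_norml.
  by case: (_ \in F); case: (_ == a); rewrite /= ?mulr0n ?mulr1n ?mul1r ?mul0r; lra.
have := ler_normD (X - Y) Y; rewrite subrK => h.
have -> : e = 8 * t by rewrite /t; field.
have := mulr_ge0 NR (ltW t0); lra.
Qed.

End LetterFrequency.

(** * Two automata constructions *)

(** Each letter appended to [w] adds one bit, recording whether the shorter word had just been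
    completed when that letter was read. *)
Lemma suffix_dfa (S : countType) (w : seq S) :
  exists (K : finType) (d : K -> S -> K) (k0 : K) (FK : {set K}),
    forall u, (foldl d k0 u \in FK) = suffix w u.
Proof.
elim/last_ind: w => [|w a [K [d [k0 [FK h]]]]].
  by exists unit, (fun=> fun=> tt), tt, [set: unit]%SET => u; rewrite inE suffix0s.
exists (K * bool)%type, (fun kb c => (d kb.1 c, (kb.1 \in FK) && (c == a))), (k0, false).
exists [set kb | kb.2]%SET => u.
have E v b : (foldl (fun kb c => (d kb.1 c, (kb.1 \in FK) && (c == a))) (k0, b) v).1 = foldl d k0 v.
  by elim/last_ind: v => // v c IHv; rewrite !foldl_rcons /= IHv.
elim/last_ind: u => [|u c _]; first by rewrite inE /= suffixs0; case: w {h}.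
by rewrite inE foldl_rcons /= E h suffix_rcons andbC eq_sym.
Qed.

(** States are treated one by one: if some continuation leads the next state into [F], it is
    appended; both alternatives survive such extensions for the earlier states. *)
Lemma visiting_word (S : Type) (Q : finType) (delta : Q -> S -> Q) (F : {set Q}) :
  exists u, forall q,
    (exists2 j, (j <= size u)%N & foldl delta q (take j u) \in F) \/
    (forall v, foldl delta q (u ++ v) \notin F).
Proof.
suff [u hu] : exists u, forall q, q \in enum Q ->
    (exists2 j, (j <= size u)%N & foldl delta q (take j u) \in F) \/
    (forall v, foldl delta q (u ++ v) \notin F).
  by exists u => q; apply: hu; rewrite mem_enum.
elim: (enum Q) => [|q0 s [u IHs]]; first by exists [::].
have ext v q : q \in s ->
    (exists2 j, (j <= size (u ++ v))%N & foldl delta q (take j (u ++ v)) \in F) \/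
    (forall v', foldl delta q ((u ++ v) ++ v') \notin F).
  case/IHs => [[j ju jF]|dead]; [left|right].
    by exists j; rewrite ?size_cat ?(leq_trans ju) ?leq_addr// takel_cat.
  by move=> v'; rewrite -catA.
have [[v vF]|nov] := pselect (exists v, foldl delta q0 (u ++ v) \in F).
  exists (u ++ v) => q; rewrite inE => /predU1P[->|/ext//].
  by left; exists (size (u ++ v)); rewrite ?take_size.
exists u => q; rewrite inE => /predU1P[->|/IHs//].
by right => v; apply/negP => vF; apply: nov; exists v.
Qed.

(** * Word frequencies in the selected sequence *)

Section BernoulliAgafonov.
Variables (R : realType) (S : countType) (p : S -> R) (alpha : nat -> S).
Hypothesis p_gt0 : forall a, 0 < p a.
Hypothesis p_sum1 : (\esum_(a in [set: S]) (p a)%:E = 1)%E.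
Hypothesis alpha_freq : forall x,
  sublinear (fun N => endings R x alpha N - (\prod_(a <- x) p a) * N%:R).
Variables (Q : finType) (delta : Q -> S -> Q) (qs : Q) (F : {set Q}).
Variable sigma : nat -> nat.
Let state k := foldl delta qs (mkseq alpha k).
Hypothesis sigmaS : forall n, (sigma n < sigma n.+1)%N.
Hypothesis sigma_sel : forall n, state (sigma n) \in F.
Hypothesis sel_sigma : forall i, state i \in F -> exists n, sigma n = i.

Let sel i := state i \in F.

Lemma selection_density : exists c : R, exists M0, forall M, (M0 <= M)%N ->
  (sigma M)%:R <= c * M%:R.
Proof.
have [u hu] := visiting_word delta F.
set n := size u; pose m : R := \prod_(a <- u) p a.
have m0 : 0 < m by apply: prodr_gt0.
have stateD i j : state (i + j) = foldl delta (state i) (block alpha i j).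
  by rewrite /state mkseqD foldl_cat.
have take_block i j : (j <= n)%N -> take j (block alpha i n) = block alpha i j.
  by move=> jn; rewrite /block /mkseq -map_take take_iota (minn_idPl jn).
have hit i : (block alpha i n == u)%:R <= \sum_(j < n.+1) (sel (i + j)%N)%:R :> R.
  case: eqP => [E|_]; last by apply: sumr_ge0.
  have [[j ju jF]|dead] := hu (state i).
    rewrite (bigD1 (Ordinal (ju : (j < n.+1)%N))) //= /sel stateD -take_block // E jF.
    by rewrite lerDl sumr_ge0.
  (* In the dead case nothing is selected after [u], yet [sigma (i + n)] is a selected position at
     or beyond [i + n]. *)
  have := sigma_sel (i + n)%N; have := leq_sigma sigmaS (i + n)%N => /subnKC <-.
  rewrite -addnA stateD {1}/block /mkseq iotaD map_cat -/(mkseq _ n) -/(block alpha i n) E.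
  by move/negP: (dead [seq alpha (i + j)%N | j <- iota (0 + n) (sigma (i + n) - (i + n))]).
pose n1 : R := n.+1%:R.
have count_le N : endings R u alpha (N + n) <=
    n1 * (\sum_(i < N) (sel i)%:R) + n1 * (2 * n1).
  rewrite -sum_block; apply: le_trans; first by apply: ler_sum => i _; exact: hit.
  have g1 k : `|(sel k)%:R| <= 1 :> R by case: (sel k); rewrite ?normr1 ?normr0.
  have := window_sum n.+1 N g1; rewrite ler_norml -/n1; lra.
have [|N0 hN0] := sublinear_shift n (alpha_freq u) (e := m / 2); first by rewrite divr_gt0.
(* Eventually [u] has frequency at least [m / 2] and [count_le] bounds its count; the additive
   constant is absorbed using [1 <= M]. *)
exists ((m / 2)^-1 * (n1 + n1 * (2 * n1))), (maxn N0 1) => M; rewrite geq_max => /andP[NM M1].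
have sM : (N0 <= sigma M)%N by apply: leq_trans NM (leq_sigma sigmaS M).
rewrite -mulrA ler_pdivlMl ?divr_gt0//.
have := count_le (sigma M).
have -> : \sum_(i < sigma M) (sel i)%:R = M%:R :> R.
  under eq_bigr do rewrite -[_%:R]mulr1.
  by rewrite (sum_selected sigmaS sigma_sel sel_sigma (fun=> 1)) sumr_const card_ord.
have := hN0 _ sM; rewrite ler_norml -/m natrD => /andP[h _].
have n0 : 0 <= n%:R :> R by [].
have := mulr_ge0 (ltW m0) n0.
have n10 : 0 <= n1 * (2 * n1) by rewrite !mulr_ge0.
have : n1 * (2 * n1) * 1 <= n1 * (2 * n1) * M%:R by apply: ler_wpM2l => //; rewrite ler1n.
lra.
Qed.

Let gamma := alpha \o sigma.

Lemma selected_rcons w a :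
  sublinear (fun M => endings R (rcons w a) gamma M.+1 - p a * endings R w gamma M).
Proof.
have [K [d [k0 [FK hK]]]] := suffix_dfa w.
(* The second component advances only at selected letters, so it reads the selected word and tests
   whether that word ends with [w]. *)
pose dp (x : Q * K) c := (delta x.1 c, if x.1 \in F then d x.2 c else x.2).
pose F' := [set x : Q * K | (x.1 \in F) && (x.2 \in FK)]%SET.
have dpE n : foldl dp (qs, k0) (mkseq alpha n) =
    (state n, foldl d k0 [seq alpha j | j <- iota 0 n & sel j]).
  elim: n => // n IHn; rewrite -[in iota 0 n.+1]addn1 iotaD filter_cat map_cat foldl_cat.
  rewrite /state mkseqS !foldl_rcons IHn /dp /= -/(state n) -/(sel n).
  by case: (sel n).
have [c hc] := selection_density.
have p_ge0 b : 0 <= p b by apply: ltW.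
have := letter_frequency p_ge0 p_sum1 alpha_freq dp (qs, k0) F' a.
move=> /(sublinear_comp (leq_sigma sigmaS) hc); apply: eq_sublinear => M.
under eq_bigr do rewrite dpE inE /= -/(sel _) hK -mulnb natrM -mulrA.
rewrite (sum_selected sigmaS sigma_sel sel_sigma (fun i =>
  (suffix w [seq alpha j | j <- iota 0 i & sel j])%:R * ((alpha i == a)%:R - p a))).
rewrite endings_rcons /endings mulr_sumr -sumrB; apply: eq_bigr => k _.
rewrite (filter_selected sigmaS sigma_sel sel_sigma) -map_comp -/(mkseq gamma k).
by rewrite mulrBr; congr (_ - _); rewrite mulrC.
Qed.

Lemma selected_frequency w :
  sublinear (fun N => endings R w gamma N - (\prod_(a <- w) p a) * N%:R).
Proof.
elim/last_ind: w => [|w a IHw].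
  by apply: eq_sublinear (@sublinear0 R) => N; rewrite endings_nil big_nil; ring.
apply: (@sublinear_shift_inv _ 1).
have := sublinearD (selected_rcons w a) (sublinearZ (p a) IHw).
move/sublinearB/(_ (sublinear_bounded (fun=> lexx `|\prod_(a <- w) p a * p a|))).
by apply: eq_sublinear => N; rewrite addn1 -natr1 -cats1 big_cat big_seq1 /=; ring.
Qed.

End BernoulliAgafonov.

(** * From Bernoulli to Agafonov to Postnikova *)

Section Equivalence.
Variables (R : realType) (S : countType) (mu : seq S -> R).

Lemma positive_bernoulli_agafonov : probability_map mu ->
  positive_bernoulli_induced mu -> agafonov_property mu.
Proof.
move=> [mu1 _] [p [p01 [p1 muE]]] Q delta qs F alpha dalpha _ sigma [s1 [s2 s3]].
have p0 a : 0 < p a by case/andP: (p01 a).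
have muE' w : mu w = \prod_(a <- w) p a.
  by case: w => [|b w]; rewrite ?mu1 ?big_nil// muE.
have freq x : sublinear (fun N => endings R x alpha N - (\prod_(a <- x) p a) * N%:R).
  by rewrite -muE'; exact: sublinear_endings.
apply/mu_distributedP => w _; rewrite muE'.
exact: (selected_frequency p0 p1 freq s1 s2 s3 w).
Qed.

Lemma postnikova_suffix (w u : seq S) : postnikova_strategy w u <-> suffix w u.
Proof. by split=> /suffixP. Qed.

Lemma agafonov_postnikova : agafonov_property mu -> postnikova_property mu.
Proof.
move=> ag w alpha dalpha.
have [K [d [k0 [FK hK]]]] := suffix_dfa w.
suff -> : postnikova_strategy w = dfa_strategy d k0 FK by exact: ag.
apply/seteqP; split=> u; rewrite /dfa_strategy /= hK => /postnikova_suffix //.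
Qed.

End Equivalence.

(** * Multiplicativity of [mu], and modifications on sets of density zero *)

Section Multiplicativity.
Variables (R : realType) (S : countType) (mu : seq S -> R).
Implicit Types (w : seq S) (alpha beta gamma : nat -> S).

Lemma suffix_infinite w alpha :
  mu [::] = 1 -> mu_distributed mu alpha -> 0 < mu w ->
  forall m, exists i, (m <= i)%N /\ suffix w (mkseq alpha i).
Proof.
move=> mu1 dalpha w0 m; apply: contrapT => no.
have E N : endings R w alpha (N + m) = endings R w alpha m.
  rewrite /endings addnC big_split_ord /= [X in _ + X]big1 ?addr0// => i _.
  apply/eqP; rewrite pnatr_eq0 eqb0; apply/negP => h; apply: no.
  by exists (m + i)%N; rewrite leq_addr.
have := sublinear_shift m (sublinear_endings w mu1 dalpha).
move/sublinearB/(_ (sublinear_bounded (fun=> lexx `|endings R w alpha m - mu w * m%:R|))).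
move=> /sublinearN h.
have /sublinear_natr_eq0 : sublinear (fun N => mu w * N%:R).
  by apply: eq_sublinear h => N; rewrite E natrD; ring.
by apply/eqP; rewrite gt_eqF.
Qed.

(** If [mu w = 0], then [rcons w a] is no more frequent than [w]. Otherwise the occurrences of
    [rcons w a] are counted both in [alpha] and as letters [a] in the sequence selected by [w]. *)
Lemma postnikova_mul w a alpha :
  probability_map mu -> postnikova_property mu -> mu_distributed mu alpha ->
  mu (rcons w a) = mu w * mu [:: a].
Proof.
move=> [mu1 [mu01 _]] post dalpha.
have muw0 : 0 <= mu w.
  by case: w => [|b w]; rewrite ?mu1 //; case/andP: (mu01 (b :: w) isT).
have sw := sublinear_endings w mu1 dalpha.
have swa := sublinear_endings (rcons w a) mu1 dalpha.
have [muw|muw] := eqVneq (mu w) 0.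
  have h1 : sublinear (endings R w alpha).
    by apply: eq_sublinear sw => N; rewrite muw mul0r subr0.
  have h2 : sublinear (fun N => endings R (rcons w a) alpha (N + 1)).
    apply: sublinear_le h1 => N; rewrite ger0_norm ?endings_ge0// addn1 endings_rcons.
    by apply: ler_sum => k _; apply: ler_piMr => //; case: (_ == a).
  have h3 := sublinearB (sublinear_shift_inv h2) swa.
  rewrite muw mul0r; apply: sublinear_natr_eq0.
  by apply: eq_sublinear h3 => N; ring.
have {}muw : 0 < mu w by rewrite lt_def muw.
have inf := suffix_infinite mu1 dalpha muw.
have [sigma [s1 [s2 s3]]] := enumeration_exists inf.
have /mu_distributedP/(_ [:: a] isT) sg : mu_distributed mu (alpha \o sigma).
  apply: (post w alpha dalpha).
    by move=> m; have [i [mi wi]] := inf m; exists i; split=> //; apply/postnikova_suffix.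
  by split=> //; split=> [n|i /postnikova_suffix/s3//]; apply/postnikova_suffix/s2.
have Ew M : endings R w alpha (sigma M) = M%:R.
  rewrite /endings; under eq_bigr do rewrite -[_%:R]mulr1.
  by rewrite (sum_selected s1 s2 s3 (fun=> 1)) sumr_const card_ord.
have Ewa M : endings R (rcons w a) alpha (sigma M).+1 = endings R [:: a] (alpha \o sigma) M.+1.
  rewrite endings_rcons (sum_selected s1 s2 s3 (fun i => (alpha i == a)%:R)).
  rewrite (endings_rcons _ [::]); apply: eq_bigr => k _.
  by rewrite suffix0s mul1r.
have hc : exists M0, forall M, (M0 <= M)%N -> (sigma M)%:R <= (2 / mu w) * M%:R.
  have [|N0 hN0] := sw (mu w / 2); first by rewrite divr_gt0.
  exists N0 => M NM; have := hN0 _ (leq_trans NM (leq_sigma s1 M)).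
  rewrite Ew ler_norml => /andP[h _].
  by rewrite mulrAC ler_pdivlMr //; lra.
have A1 := sublinear_comp (leq_sigma s1) hc sw.
have A2 := sublinear_comp (leq_sigma s1) hc (sublinear_shift 1 swa).
have A3 := sublinear_shift 1 sg.
have A4 := sublinearB (sublinearB A3 A2)
  (sublinear_bounded (fun=> lexx `|mu (rcons w a) - mu [:: a]|)).
(* This combination cancels [sigma M] and leaves [mu (rcons w a) - mu w * mu [:: a]] times [M]. *)
have A5 := sublinearD (sublinearZ (mu (rcons w a)) A1) (sublinearZ (mu w) A4).
apply/eqP; rewrite -subr_eq0; apply/eqP/sublinear_natr_eq0.
by apply: eq_sublinear A5 => M; rewrite Ew !addn1 Ewa -!natr1; ring.
Qed.

Lemma constant_distributed a gamma :
  mu_distributed mu gamma -> (forall k, gamma k = a) -> mu [:: a] = 1.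
Proof.
move=> /mu_distributedP/(_ [:: a] isT) /(sublinear_shift 1) h ga.
have h1 := sublinearD h (sublinear_bounded (fun=> lexx `|mu [:: a]|)).
apply/eqP; rewrite eq_sym -subr_eq0; apply/eqP/sublinear_natr_eq0.
apply: eq_sublinear h1 => N; rewrite addn1 (endings_rcons _ [::]).
rewrite (eq_bigr (fun=> 1)) => [|k _]; last by rewrite suffix0s ga eqxx mul1r.
by rewrite sumr_const card_ord -natr1; ring.
Qed.

(** A suffix test sees only the last [size w] letters, so each modified position disturbs at most
    [size w] tests. *)
Lemma endings_diff w alpha beta N :
  \sum_(k < N) `|(suffix w (mkseq alpha k))%:R - (suffix w (mkseq beta k))%:R| <=
  (size w)%:R * \sum_(i < N) (alpha i != beta i)%:R :> R.
Proof.
elim/last_ind: w N => [|w a IHw] N.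
  by rewrite mul0r big1 // => k _; rewrite !suffix0s subrr normr0.
case: N => [|N]; first by rewrite !big_ord0 mulr0.
rewrite big_ord_recl !suffix_mkseq_lt ?size_rcons //= subrr normr0 add0r.
apply: le_trans (_ : \sum_(k < N) (`|(suffix w (mkseq alpha k))%:R - (suffix w (mkseq beta k))%:R|
   + (alpha k != beta k)%:R) <= _).
  apply: ler_sum => k _; rewrite /bump /= !suffix_mkseqS.
  have [->|ab] := eqVneq (alpha k) (beta k).
    rewrite addr0; case: (_ == a); rewrite ?andbT ?andbF // subrr normr0; exact: normr_ge0.
  apply: le_trans (_ : 1 <= _); last by rewrite lerDr.
  by case: (_ && _); case: (_ && _); rewrite ?subrr ?subr0 ?sub0r ?normrN ?normr1 ?normr0.
rewrite big_split /= -natr1 mulrDl mul1r.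
have le : \sum_(i < N) (alpha i != beta i)%:R <= \sum_(i < N.+1) (alpha i != beta i)%:R :> R.
  by rewrite big_ord_recr /= lerDl.
apply: lerD => //; apply: le_trans (IHw N) _; exact: ler_wpM2l.
Qed.

Lemma distributed_modify alpha beta : mu_distributed mu alpha ->
  sublinear (fun N => \sum_(i < N) (alpha i != beta i)%:R : R) ->
  mu_distributed mu beta.
Proof.
move=> /mu_distributedP dalpha sd; apply/mu_distributedP => w w0.
have h : sublinear (fun N => endings R w alpha N - endings R w beta N).
  apply: sublinear_le (sublinearZ (size w)%:R sd) => N.
  rewrite /endings -sumrB; apply: le_trans (ler_norm_sum _ _ _) (endings_diff _ _ _ _).
by apply: eq_sublinear (sublinearB (dalpha w w0) h) => N; ring.
Qed.

End Multiplicativity.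

(* Starting the squares at 9 makes consecutive ones at least 7 apart. *)
Definition shifted_square r i : bool := `[< exists k, i = (k.+3 ^ 2 + r)%N >].

Lemma square_gap k l : (k < l)%N -> (k.+3 ^ 2 + 7 <= l.+3 ^ 2)%N.
Proof. nia. Qed.

Lemma sublinear_shifted_square (R : realType) r :
  sublinear (fun N => \sum_(i < N) (shifted_square r i)%:R : R).
Proof.
move=> e e0.
have [M' hM'] := natr_ge_exists (2 / e); pose M := M'.+1.
have hM : 1 <= M%:R * (e / 2).
  have : 2 / e <= M%:R by apply: le_trans hM' _; rewrite ler_nat.
  by rewrite ler_pdivrMr //; lra.
have [N0 hN0] := natr_ge_exists (M.+1%:R / (e / 2)); exists N0 => N NN.
(* [K] stands in for the square root of [N]: its square is at least [N], while [K <= e * N] for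
   large [N]. *)
pose K := (M + N %/ M + 1)%N.
have NK : (N <= K * K)%N.
  have := divn_eq N M; have : (N %% M < M)%N by rewrite ltn_mod.
  rewrite /K; move: (N %/ M)%N (N %% M)%N => x y; nia.
rewrite ger0_norm; last exact: sumr_ge0.
apply: le_trans (_ : K%:R <= _).
  apply: le_trans (_ : \sum_(i < N) \sum_(k < K) (i == k.+3 ^ 2 + r :> nat)%N%:R <= _).
    apply: ler_sum => i _; rewrite /shifted_square.
    case: asboolP => [[k ik]|_]; last exact: sumr_ge0.
    have kK : (k < K)%N by have := ltn_ord i; rewrite ik; nia.
    by rewrite (bigD1 (Ordinal kK)) //= -ik eqxx lerDl; apply: sumr_ge0.
  rewrite exchange_big /= -[K in K%:R]card_ord -sumr_const; apply: ler_sum => k _.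
  have [kN|kN] := ltnP (k.+3 ^ 2 + r) N; last first.
    rewrite big1 // => i _; case: eqP => // E; have := ltn_ord i; lia.
  rewrite (bigD1 (Ordinal kN)) //= eqxx big1 ?addr0// => i /eqP ne.
  by case: eqP => // E; case: ne; apply: val_inj.
have h1 : M.+1%:R <= e / 2 * N%:R.
  rewrite mulrC -ler_pdivrMr ?divr_gt0//; apply: le_trans hN0 _.
  by rewrite ler_nat.
have h2 : (N %/ M)%:R <= e / 2 * N%:R.
  apply: le_trans (_ : (N %/ M)%:R * (M%:R * (e / 2)) <= _).
    by apply: ler_peMr.
  rewrite mulrA [X in _ <= X]mulrC; apply: ler_wpM2r; first by rewrite divr_ge0 // ltW.
  by rewrite -natrM ler_nat leq_trunc_div.
by rewrite /K addn1 -addSn natrD; lra.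
Qed.

(** * Positivity of the letters, and the Bernoulli form of [mu] *)

Section Positivity.
Variables (R : realType) (S : countType) (mu : seq S -> R).

(* If [mu a = 0], overwrite a density-zero set of positions so that the letters [a] occur
   exactly in blocks [a a d a] placed at the squares: the strategy for [a a d] then selects
   the constant sequence [a a a ...]. *)
Lemma postnikova_positive a alpha :
  postnikova_property mu -> mu_distributed mu alpha -> mu [:: a] <> 0.
Proof.
move=> post dalpha mua.
have [d da] : exists d, d != a.
  apply: contrapT => no; have := constant_distributed (a := a) dalpha.
  rewrite mua => /(_ _)/eqP; rewrite eq_sym oner_eq0 => h; apply/notF/h => k.
  by apply/eqP; apply: contrapT => /negP ne; apply: no; exists (alpha k).
pose ina i := [|| shifted_square 0 i, shifted_square 1 i | shifted_square 3 i].
(* The letters [a] of [alpha] outside the planted blocks are erased too; they have density zero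
   because [mu [:: a] = 0]. *)
pose beta i := if ina i then a else if shifted_square 2 i || (alpha i == a) then d else alpha i.
have beta_a i : (beta i == a) = ina i.
  rewrite /beta; case: ifP => _; first by rewrite eqxx.
  by case: ifP => [|/negbT]; [rewrite (negPf da)|rewrite negb_or => /andP[_ /negPf]].
have dbeta : mu_distributed mu beta.
  apply: (distributed_modify dalpha).
  have sa : sublinear (fun N => \sum_(i < N) (alpha i == a)%:R : R).
    have /mu_distributedP/(_ [:: a] isT)/(sublinear_shift 1) := dalpha.
    apply: eq_sublinear => N; rewrite mua mul0r subr0 addn1 (endings_rcons _ [::]).
    by apply: eq_bigr => k _; rewrite suffix0s mul1r.
  have sq := @sublinear_shifted_square R.
  have := sublinearD sa (sublinearD (sublinearD (sq 0%N) (sq 1%N)) (sublinearD (sq 2%N) (sq 3%N))).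
  apply: sublinear_le => N; rewrite ger0_norm ?sumr_ge0//= -!big_split /=.
  apply: ler_sum => i _; case E: (alpha i != beta i); last by rewrite !addr_ge0.
  move: E; rewrite /beta /ina.
  case: (shifted_square 0 i); case: (shifted_square 1 i); case: (shifted_square 2 i);
  case: (shifted_square 3 i); case: (alpha i == a) => /=; rewrite ?eqxx //= => _; lra.
have gap k l r s : (k.+3 ^ 2 + r = l.+3 ^ 2 + s)%N -> (r <= 6)%N -> (s <= 6)%N -> r = s.
  by case: (ltngtP k l) => [/square_gap|/square_gap|->]; lia.
have inaP i : ina i -> exists k r, i = (k.+3 ^ 2 + r)%N /\ (r \in [:: 0; 1; 3])%N.
  by case/or3P => /asboolP[k ->]; exists k; [exists 0%N|exists 1%N|exists 3%N].
have ina_sq k r : (r \in [:: 0; 1; 3])%N -> ina (k.+3 ^ 2 + r)%N.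
  rewrite !inE => /or3P[] /eqP ->; apply/or3P;
    [apply: Or31|apply: Or32|apply: Or33]; apply/asboolP; by exists k.
have beta_d k : beta (k.+3 ^ 2 + 2)%N = d.
  have h : ~~ ina (k.+3 ^ 2 + 2)%N.
    apply/negP => /inaP[l [r [E]]]; rewrite !inE => hr.
    have := gap _ _ _ _ E isT; case/or3P: hr => /eqP -> /(_ isT) //.
  rewrite /beta (negPf h) (_ : shifted_square 2 _) //; apply/asboolP; by exists k.
have blockE m : (block beta m 3 == [:: a; a; d]) =
    [&& beta m == a, beta (m + 1)%N == a & beta (m + 2)%N == d].
  by rewrite /block /mkseq /= addn0 !eqseq_cons /= andbT.
have selE m : suffix [:: a; a; d] (mkseq beta (m + 3)) -> beta (m + 3)%N = a.
  rewrite (suffix_mkseqD [:: a; a; d]) blockE !beta_a => /and3P[h1 h2 _]; apply/eqP.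
  have [k [r [E hr]]] := inaP _ h1; have [l [s [E' hs]]] := inaP _ h2.
  have {}E' : (k.+3 ^ 2 + r.+1 = l.+3 ^ 2 + s)%N by rewrite addnS -E -addn1.
  have := gap _ _ _ _ E' => {E'} E'.
  (* Adjacent letters [a] have offsets [r] and [r.+1], both among 0, 1, 3; only 0 and 1 are
     consecutive. *)
  have r0 : r = 0%N.
    move: hr hs E'; rewrite !inE => /or3P[]/eqP -> /or3P[]/eqP -> // /(_ isT isT) //.
  by rewrite beta_a E r0 addn0; apply: ina_sq.
have inf : forall m, exists i, (m <= i)%N /\ suffix [:: a; a; d] (mkseq beta i).
  move=> m; exists (m.+3 ^ 2 + 3)%N; split; first nia.
  rewrite (suffix_mkseqD [:: a; a; d]) blockE !beta_a beta_d eqxx andbT.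
  by rewrite ina_sq // -[(m.+3 ^ 2)%N]addn0 ina_sq.
have [sigma [s1 [s2 s3]]] := enumeration_exists inf.
have : mu_distributed mu (beta \o sigma).
  apply: (post [:: a; a; d] beta dbeta).
    by move=> m; have [i [mi wi]] := inf m; exists i; split=> //; apply/postnikova_suffix.
  by split=> //; split=> [n|i /postnikova_suffix/s3//]; apply/postnikova_suffix/s2.
move/constant_distributed => /(_ a) h; have : (0 : R) = 1.
  rewrite -mua; apply: h => k /=.
  have sz : (3 <= sigma k)%N by have := size_suffix (s2 k); rewrite size_mkseq.
  by have := s2 k; rewrite -(subnK sz); exact: selE.
by move/eqP; rewrite eq_sym oner_eq0.
Qed.

Lemma postnikova_positive_bernoulli :
  probability_map mu -> (exists alpha, mu_distributed mu alpha) ->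
  postnikova_property mu -> positive_bernoulli_induced mu.
Proof.
move=> pm [alpha dalpha] post; have [mu1 [mu01 musum]] := pm.
exists (fun a => mu [:: a]); split=> [a|].
  have /andP[h0 h1] := mu01 [:: a] isT; rewrite h1 andbT lt_def h0 andbT.
  by apply/eqP; exact: postnikova_positive post dalpha.
split.
  rewrite -(musum 1%N isT); apply/esym; apply: reindex_esum; split.
  - by move=> a _.
  - by move=> a b _ _ [].
  - by case=> [|a [|b w]] //= _; exists a.
move=> w _; elim/last_ind: w => [|w a IHw]; first by rewrite big_nil.
by rewrite (postnikova_mul w a pm post dalpha) IHw -cats1 big_cat big_seq1.
Qed.

End Positivity.

Theorem theorem3p1 (R : realType) (S : countType) (mu : seq S -> R) :
  (exists a : S, True) ->
  probability_map mu ->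
  (exists alpha : nat -> S, mu_distributed mu alpha) ->
  (positive_bernoulli_induced mu <-> postnikova_property mu) /\
  (postnikova_property mu <-> agafonov_property mu).
Proof.
move=> _ pm ex.
have h13 := positive_bernoulli_agafonov pm.
have h32 := @agafonov_postnikova R S mu.
have h21 := postnikova_positive_bernoulli pm ex.
by split; split=> // h; [apply/h32/h13|apply/h13/h21].
Qed.
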